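(* Let $R$ be an associative ring with identity and let $\mathcal{X}$ be a precovering class of left $R$-modules closed under isomorphisms, finite direct sums and direct summands. The following conditions are equivalent for a left $R$-module $M$: (1) $M$ is (isomorphic to) a pure submodule of a module in $\mathcal{X}$. (2) Every pure-injective left $R$-module belongs to $\mathcal{X}^{-1}(M)$. (3) $PE(M)\in\mathcal{X}^{-1}(M)$. (4) For any right $R$-module $N$, $N^+\in\mathcal{X}^{-1}(M)$. (5) For any pure-projective right $R$-module $P$, $P^+\in\mathcal{X}^{-1}(M)$.
   Context: Modules are unital left $R$-modules unless stated otherwise. $PE(M)$ denotes a pure-injective preenvelope of $M$, and $N^+=\mathrm{Hom}_{\mathbb{Z}}(N,\mathbb{Q}/\mathbb{Z})$ is the character module of $N$. For a class $\mathcal{X}$ of modules, an $\mathcal{X}$-precover of $N$ is a morphism $g:X\to N$ with $X\in\mathcal{X}$ such that $\mathrm{Hom}(X',X)\to\mathrm{Hom}(X',N)$ is surjective for every $X'\in\mathcal{X}$; preenvelopes are defined dually; $\mathcal{X}$ is precovering if every module has an $\mathcal{X}$-precover. The $\mathcal{X}$-precover completing domain $\mathcal{X}^{-1}(M)$ of a module $M$ is the class of all modules $N$ such that for every morphism $f:M\to N$ and every $\mathcal{X}$-precover $g:X\to N$ there is a morphism $h:M\to X$ with $gh=f$. *)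

(* Defs.v *)
From HB Require Import structures.
From mathcomp Require Import all_boot all_order all_algebra.
From mathcomp Require Import generic_quotient ring_quotient freeg.
From mathcomp Require Import boolp functions.

Set Implicit Arguments.
Unset Strict Implicit.
Unset Printing Implicit Defensive.

Import GRing.Theory Num.Theory.
Import Quotient.

Local Open Scope ring_scope.
Local Open Scope quotient_scope.

(* Left R-modules are [lmodType R]; right R-modules are [lmodType R^c], so that,
   for N : lmodType R^c, the element n.r is written r *: n. *)

Definition int_rat : {pred rat} := fun q => q \is a Num.int.

Lemma int_rat_zmod_closed : zmod_closed int_rat.
Proof. by split=> [|x y]; [exact: rpred0 | exact: rpredB]. Qed.

HB.instance Definition _ := GRing.isZmodClosed.Build rat int_rat
  int_rat_zmod_closed.

Definition QZ : zmodType := {quot (int_rat : zmodClosed rat)}.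

Section CharacterModule.
Variables (R : pzRingType) (N : lmodType R^c).

Definition is_char : {pred N -> QZ} :=
  [pred chi : N -> QZ | `[< zmod_morphism chi >]].

Lemma is_char_zmod_closed : zmod_closed is_char.
Proof.
split=> [|f g].
  by rewrite inE; apply/asboolP => x y /=; rewrite subr0.
rewrite !inE => /asboolP fA /asboolP gA; apply/asboolP => x y.
have E z : (f - g) z = f z - g z by [].
by rewrite !E fA gA !opprD addrACA.
Qed.

HB.instance Definition _ := GRing.isZmodClosed.Build _ is_char
  is_char_zmod_closed.

(* N^+ = Hom_Z(N, Q/Z) *)
Record character_module := CharacterModule {
  char_fun :> N -> QZ;
  char_funP : char_fun \in is_char }.

HB.instance Definition _ := [isSub for char_fun].
HB.instance Definition _ := [Choice of character_module by <:].
HB.instance Definition _ :=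
  [SubChoice_isSubZmodule of character_module by <:].

Lemma char_zmod_morphism (chi : character_module) : zmod_morphism chi.
Proof. by have /asboolP := char_funP chi. Qed.

HB.instance Definition _ (chi : character_module) :=
  GRing.isZmodMorphism.Build N QZ chi (char_zmod_morphism chi).

Lemma char_scale_subproof (r : R) (chi : character_module) :
  (fun n : N => chi ((r : R^c) *: n)) \in is_char.
Proof. by rewrite inE; apply/asboolP => x y; rewrite scalerBr raddfB. Qed.

(* (r chi)(n) = chi(n r) *)
Definition char_scale r chi := CharacterModule (char_scale_subproof r chi).

Lemma char_scaleA a b chi :
  char_scale a (char_scale b chi) = char_scale (a * b) chi.
Proof. by apply/val_inj/funext => n /=; rewrite scalerA. Qed.

Lemma char_scale1 : left_id 1 char_scale.
Proof. by move=> chi; apply/val_inj/funext => n /=; rewrite scale1r. Qed.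

Lemma char_scaleDr : right_distributive char_scale +%R.
Proof. by move=> a f g; apply/val_inj/funext. Qed.

Lemma char_scaleDl chi :
  {morph char_scale^~ chi : a b / a + b >-> a + b}.
Proof.
by move=> a b; apply/val_inj/funext => n /=; rewrite scalerDl raddfD.
Qed.

HB.instance Definition _ := GRing.Zmodule_isLmodule.Build R character_module
  char_scaleA char_scale1 char_scaleDr char_scaleDl.

End CharacterModule.

Section Tensor.
Variables (R : pzRingType) (N : lmodType R^c) (A : lmodType R).

Inductive tens_rel : {freeg (N * A)} -> Prop :=
| TensDl n n' a : tens_rel (<<(n + n', a)>> - <<(n, a)>> - <<(n', a)>>)
| TensDr n a a' : tens_rel (<<(n, a + a')>> - <<(n, a)>> - <<(n, a')>>)
| TensZ (r : R) n a :
    tens_rel (<<((r : R^c) *: n, a)>> - <<(n, r *: a)>>).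

Definition tens_ker : {pred {freeg (N * A)}} :=
  [pred x | `[< forall S : zmodClosed {freeg (N * A)},
                  (forall y, tens_rel y -> y \in S) -> x \in S >]].

Lemma tens_ker_zmod_closed : zmod_closed tens_ker.
Proof.
split=> [|x y]; rewrite !inE.
  by apply/asboolP => S _; rewrite rpred0.
move=> /asboolP xS /asboolP yS; apply/asboolP => S relS.
by rewrite rpredB ?xS ?yS.
Qed.

HB.instance Definition _ := GRing.isZmodClosed.Build _ tens_ker
  tens_ker_zmod_closed.

Definition tensor : zmodType := {quot (tens_ker : zmodClosed _)}.

Definition tens (n : N) (a : A) : tensor := \pi_tensor <<(n, a)>>.

Lemma tens_eqP (x y : {freeg (N * A)}) :
  \pi_tensor x = \pi_tensor y <-> x - y \in tens_ker.
Proof. by rewrite idealrBE; split=> /eqP. Qed.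

Definition balanced (G : zmodType) (b : N -> A -> G) :=
  [/\ forall n n' a, b (n + n') a = b n a + b n' a,
      forall n a a', b n (a + a') = b n a + b n a' &
      forall (r : R) n a, b ((r : R^c) *: n) a = b n (r *: a)].

Lemma tens_balanced : balanced tens.
Proof.
have K x : tens_rel x -> x \in tens_ker by move=> ?; apply/asboolP => S; exact.
split=> [n n' a|n a a'|r n a]; rewrite /tens -?raddfD; apply/tens_eqP.
- by rewrite opprD addrA; apply/K/TensDl.
- by rewrite opprD addrA; apply/K/TensDr.
- exact/K/TensZ.
Qed.

(* The additive map n \otimes a |-> b n a; meaningful for balanced b only. *)
Definition tens_lift (G : zmodType) (b : N -> A -> G) (t : tensor) : G :=
  fglift (fun p => b p.1 p.2 : zmodule G) (repr t).

Section Lift.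
Variables (G : zmodType) (b : N -> A -> G).
Hypothesis bP : balanced b.

Let L : {freeg (N * A)} -> zmodule G := fglift (fun p => b p.1 p.2 : zmodule G).

Let LB : zmod_morphism L := lift_is_additive _.

HB.instance Definition _ := GRing.isZmodMorphism.Build _ _ L LB.

Let Lker : {pred {freeg (N * A)}} := fun x => L x == 0.

Let Lker_closed : zmod_closed Lker.
Proof.
split=> [|x y]; rewrite !unfold_in /Lker; first by rewrite raddf0.
by move=> /eqP Lx /eqP Ly; rewrite LB Lx Ly subr0.
Qed.

HB.instance Definition _ := GRing.isZmodClosed.Build _ Lker Lker_closed.

Let L_pi x : tens_lift b (\pi_tensor x) = L x.
Proof.
apply/eqP; rewrite -subr_eq0 -[_ - _]/(L (repr (\pi_tensor x)) - L x) -raddfB.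
have /tens_eqP/asboolP : repr (\pi_tensor x) = x %[mod tensor] by rewrite reprK.
apply: (_ : _ -> _ \in Lker); apply => y.
have [bDl bDr bZ] := bP.
have LU p : L <<p>> = b p.1 p.2 by rewrite /L liftU scale1r.
case=> [n n' a|n a a'|r n a]; rewrite unfold_in /Lker !raddfB /= !LU /=.
- by rewrite bDl addrAC addrK subrr.
- by rewrite bDr addrAC addrK subrr.
- by rewrite bZ subrr.
Qed.

Lemma tens_liftE n a : tens_lift b (tens n a) = b n a.
Proof. by rewrite /tens L_pi /L liftU scale1r. Qed.

Lemma tens_lift_zmod_morphism : zmod_morphism (tens_lift b).
Proof.
move=> x y; rewrite -[x]reprK -[y]reprK -raddfB !L_pi; exact: LB.
Qed.

End Lift.
End Tensor.

Definition tensor_map (R : pzRingType) (N N' : lmodType R^c) (A A' : lmodType R)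
    (j : {linear N -> N'}) (i : {linear A -> A'}) : tensor N A -> tensor N' A' :=
  tens_lift (fun n a => tens (j n) (i a)).

Lemma tensor_map_balanced (R : pzRingType) (N N' : lmodType R^c)
    (A A' : lmodType R) (j : {linear N -> N'}) (i : {linear A -> A'}) :
  balanced (fun n a => tens (j n) (i a)).
Proof.
have [tDl tDr tZ] := tens_balanced N' A'.
by split=> [n n' a|n a a'|r n a]; rewrite ?raddfD /= ?linearZ /= ?tDl ?tDr ?tZ.
Qed.

Lemma tensor_map_tens (R : pzRingType) (N N' : lmodType R^c)
    (A A' : lmodType R) (j : {linear N -> N'}) (i : {linear A -> A'}) n a :
  tensor_map j i (tens n a) = tens (j n) (i a).
Proof. exact/(tens_liftE (tensor_map_balanced j i)). Qed.

Lemma tensor_map_zmod_morphism (R : pzRingType) (N N' : lmodType R^c)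
    (A A' : lmodType R) (j : {linear N -> N'}) (i : {linear A -> A'}) :
  zmod_morphism (tensor_map j i).
Proof. exact/(tens_lift_zmod_morphism (tensor_map_balanced j i)). Qed.

HB.instance Definition _ (R : pzRingType) (N N' : lmodType R^c)
    (A A' : lmodType R) (j : {linear N -> N'}) (i : {linear A -> A'}) :=
  GRing.isZmodMorphism.Build _ _ (tensor_map j i)
    (tensor_map_zmod_morphism j i).

Definition pure_mono (R : pzRingType) (A B : lmodType R)
    (i : {linear A -> B}) : Prop :=
  injective i /\
  forall N : lmodType R^c,
    injective (tensor_map (idfun : {linear N -> N}) i).

Definition rpure_mono (R : pzRingType) (A B : lmodType R^c)
    (i : {linear A -> B}) : Prop :=
  injective i /\
  forall L : lmodType R,
    injective (tensor_map i (idfun : {linear L -> L})).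

Definition rpure_exact (R : pzRingType) (A B C : lmodType R^c)
    (i : {linear A -> B}) (q : {linear B -> C}) : Prop :=
  [/\ rpure_mono i,
      forall b, q b = 0 <-> exists a, i a = b &
      forall c, exists b, q b = c].

Definition pure_injective (R : pzRingType) (E : lmodType R) : Prop :=
  forall (A B : lmodType R) (i : {linear A -> B}), pure_mono i ->
  forall f : {linear A -> E}, exists g : {linear B -> E}, g \o i =1 f.

Definition rpure_projective (R : pzRingType) (P : lmodType R^c) : Prop :=
  forall (A B C : lmodType R^c) (i : {linear A -> B}) (q : {linear B -> C}),
  rpure_exact i q ->
  forall f : {linear P -> C}, exists g : {linear P -> B}, q \o g =1 f.

Section Classes.
Variable R : pzRingType.
Implicit Type X : lmodType R -> Prop.

Definition precover X (G N : lmodType R) (g : {linear G -> N}) : Prop :=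
  X G /\
  forall (G' : lmodType R) (f : {linear G' -> N}), X G' ->
  exists h : {linear G' -> G}, g \o h =1 f.

Definition preenvelope X (M E : lmodType R) (u : {linear M -> E}) : Prop :=
  X E /\
  forall (E' : lmodType R) (f : {linear M -> E'}), X E' ->
  exists h : {linear E -> E'}, h \o u =1 f.

Definition precovering X : Prop :=
  forall N : lmodType R, exists (G : lmodType R) (g : {linear G -> N}),
    precover X g.

Definition iso_closed X : Prop :=
  forall (A B : lmodType R) (f : {linear A -> B}), bijective f -> X A -> X B.

(* For a precovering class the empty direct sum is covered too: 0 is a direct
   summand of any member, and there is one. *)
Definition finite_sum_closed X : Prop :=
  forall A B : lmodType R, X A -> X B -> X (A * B)%type.

Definition summand_closed X : Prop :=
  forall A B : lmodType R, X (A * B)%type -> X A.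

(* N \in X^{-1}(M) *)
Definition precover_completing_domain X (M N : lmodType R) : Prop :=
  forall (f : {linear M -> N}) (G : lmodType R) (g : {linear G -> N}),
  precover X g -> exists h : {linear M -> G}, g \o h =1 f.

End Classes.

(* Main.v *)
(** The conditions are equivalent as soon as M embeds purely into P^+ for some
    pure-projective right module P, because character modules are pure-injective
    and h is a pure monomorphism whenever g h is one.

    To find P, let B = M^+ and, for every finite set s of R-linear equations
    between elements of B, take generators e_(s, b) (b in B) subject to the
    equations of s that hold in B; P is the direct sum over s of these modules.
    Finite systems lift along pure epimorphisms, so P is pure-projective. The
    projection e_(s, b) |-> b from P to M^+ transposes to M -> P^+. For fixed s
    the map b |-> e_(s, b) is not linear, but any given instance of linearity
    holds once s is large enough; hence a functional on N \otimes M extends to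
    N \otimes P^+ by a limit over s, which gives purity. *)

From HB Require Import structures.
Require Import Defs.
From mathcomp Require Import all_boot all_order all_algebra.
From mathcomp Require Import generic_quotient ring_quotient freeg.
From mathcomp Require Import boolp classical_sets functions.

Set Implicit Arguments.
Unset Strict Implicit.
Unset Printing Implicit Defensive.

Import Order.TTheory GRing.Theory Num.Theory.

Local Open Scope ring_scope.
Local Open Scope quotient_scope.

(** * Subgroups of abelian groups and of the integers *)

Definition Additive (G H : zmodType) (f : G -> H) (fP : zmod_morphism f) :
    {additive G -> H} :=
  HB.pack_for {additive G -> H} f (GRing.isZmodMorphism.Build _ _ f fP).

Definition Linear (R : pzRingType) (U V : lmodType R) (f : U -> V)
    (fP : linear f) : {linear U -> V} :=
  HB.pack_for {linear U -> V} f (GRing.isLinear.Build R U V *:%R f fP).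

Definition subgroup (G : zmodType) (S : G -> Prop) : Prop :=
  S 0 /\ forall x y, S x -> S y -> S (x - y).

Section Subgroup.
Variables (G : zmodType) (S : G -> Prop).
Hypothesis S_sub : subgroup S.

Lemma subgroupN x : S x -> S (- x).
Proof. by case: S_sub => S0 SB Sx; rewrite -sub0r; apply: SB. Qed.

Lemma subgroupD x y : S x -> S y -> S (x + y).
Proof.
by move=> Sx Sy; rewrite -[y]opprK; apply: S_sub.2 => //; apply: subgroupN.
Qed.

Lemma subgroupMn x n : S x -> S (x *+ n).
Proof.
move=> Sx; elim: n => [|n IH]; first by rewrite mulr0n; apply: S_sub.1.
by rewrite mulrS; apply: subgroupD.
Qed.

Lemma subgroupMz x (n : int) : S x -> S (x *~ n).
Proof.
by move=> Sx; case: n => n; [|apply: subgroupN]; apply: subgroupMn.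
Qed.

End Subgroup.

(** The least positive element of [H] generates it, since remainders of division by it stay in [H];
    [d] is 0 when there is none. *)
Lemma int_subgroup_cyclic (H : int -> Prop) : subgroup H ->
  exists d : nat, H d%:Z /\ forall n, H n -> exists k, n = k * d%:Z.
Proof.
move=> HS; have [H0 HB] := HS.
case: (pselect (exists d : nat, (0 < d)%N && `[< H d%:Z >])) => [Hex|noH].
  have [d /andP[d0 /asboolP Hd] dmin] := ex_minnP Hex.
  exists d; split=> // n Hn; exists (n %/ d%:Z)%Z.
  have Hmod : H (n %% d%:Z)%Z.
    rewrite /modz; apply: HB => //; rewrite mulrC -mulrzz; exact: subgroupMz.
  rewrite [LHS](divz_eq n d%:Z) [X in _ + X](_ : _ = 0) ?addr0 //.
  have dn0 : d%:Z != 0 by rewrite -lt0n.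
  have := modz_ge0 n dn0; have := ltz_pmod n (d0 : 0 < d%:Z).
  move: Hmod; case: (modz _ _) => // -[|m] // Hm ltmd _.
  have := dmin m.+1; rewrite /= (asboolT Hm) => /(_ isT).
  by rewrite leqNgt -ltz_nat ltmd.
exists 0%N; split=> // n Hn; exists 0; rewrite mul0r; apply: contrapT => n0.
apply: noH; exists `|n|%N; rewrite absz_gt0; apply/andP; split; first exact/eqP.
apply/asboolP; rewrite abszE; case: ger0P => // _; exact: subgroupN.
Qed.

(** * Divisibility and torsion of Q/Z *)

Lemma pi_QZ_eq0 (q : rat) : (\pi_QZ q == 0) = (q \is a Num.int).
Proof. by rewrite -(raddf0 \pi_QZ) -Quotient.idealrBE subr0. Qed.

Lemma QZ_divisible (y : QZ) (d : nat) : (0 < d)%N -> exists z, z *~ d = y.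
Proof.
move=> d0; exists (\pi_QZ (repr y / d%:R)).
rewrite -[RHS]reprK -raddfMz; congr (\pi_QZ _).
by rewrite -mulrzr -pmulrn mulfVK // pnatr_eq0 -lt0n.
Qed.

Lemma QZ_torsion (d : nat) : d != 1%N -> exists2 y : QZ, y != 0 & y *~ d = 0.
Proof.
(* The class of 1/d, except that [d = 0] kills everything and the formula then gives 1/2. *)
move=> d1; exists (\pi_QZ (d.-2.+2%:R)^-1).
  rewrite pi_QZ_eq0; apply/negP => /intrP[z]; set e := _%:R => Ez.
  have e1 : 1 < e by rewrite ltr1n.
  have : 0 < (z%:~R : rat) < 1.
    by rewrite -Ez invr_gt0 invf_lt1 ?(lt_trans ltr01).
  by rewrite ltr0z -[1]/(1%:~R) ltr_int; case: (z) => // -[].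
case: d d1 => [//|[//|d]] _ /=.
rewrite -raddfMz; apply/eqP; rewrite pi_QZ_eq0.
by rewrite -mulrzr -pmulrn mulVf ?rpred1 // pnatr_eq0.
Qed.

(** * Q/Z is an injective cogenerator of abelian groups *)

Lemma subrACA (G : zmodType) (x y z t : G) :
  (x - y) - (z - t) = (x - z) - (y - t).
Proof. by rewrite !opprB addrACA [- y - z]addrC -addrACA. Qed.

Section Extension.
Variable G : zmodType.
Implicit Type A : set (G * QZ).

(** For a subgroup [A] this is single-valuedness, so that [A] is the graph of a character of a
    subgroup of [G]. *)
Definition functional A := forall y, A (0, y) -> y = 0.

Lemma pair_mulz (p : G * QZ) (n : int) : p *~ n = (p.1 *~ n, p.2 *~ n).
Proof. by rewrite [LHS]surjective_pairing (raddfMz fst) (raddfMz snd). Qed.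

(** The multiples of [x] in the domain of [A] are generated by some [x *~ d]. If [d] is positive,
    the value there can be divided by [d]; if [d = 0], take [y = 0]. *)
Lemma compatible_value A (x : G) : subgroup A -> functional A ->
  exists y, forall n z, A (x *~ n, z) -> z = y *~ n.
Proof.
move=> AS Af; have [A0 AB] := AS.
have Afun u v w : A (u, v) -> A (u, w) -> v = w.
  by move=> Av Aw; apply/subr0_eq/Af; rewrite -(subrr u);
    apply: (AB (_, _) (_, _)).
have [|d [[w Aw] dP]] := @int_subgroup_cyclic
    (fun n => exists z, A (x *~ n, z)).
  split=> [|m n [z Az] [w Aw]]; first by exists 0; rewrite mulr0z.
  by exists (z - w); rewrite mulrzBr; apply: (AB (_, _) (_, _)).
have key n z : A (x *~ n, z) -> exists k, n = k * d%:Z /\ z = w *~ k.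
  move=> Az; have [|k Ek] := dP n; first by exists z.
  exists k; split=> //; apply: Afun Az _.
  rewrite Ek mulrC mulrzA.
  by have := subgroupMz AS k Aw; rewrite pair_mulz.
case: d => [|d] in Aw dP key *.
  have w0 : w = 0 by apply: Af; rewrite mulr0z in Aw.
  by exists 0 => n z /key [k [_ ->]]; rewrite w0 !mul0rz.
have [//|y Ey] := @QZ_divisible w d.+1.
by exists y => n z /key [k [-> ->]]; rewrite -Ey mulrC mulrzA.
Qed.

Lemma character_extension A : subgroup A -> functional A ->
  exists chi : {additive G -> QZ}, forall x y, A (x, y) -> chi x = y.
Proof.
move=> AS Af.
(* Zorn's lemma also asks for the union of the empty chain, so the empty set must satisfy [P]: only
   a nonempty [B] is required to contain [A]. *)
pose P (B : set (G * QZ)) :=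
  [/\ forall u v, B u -> B v -> B (u - v), functional B
    & forall u v, B u -> A v -> B v].
have [F FP Ftot|B [[BB Bf BA] Bmax]] := @Zorn_bigcup _ P.
  split=> [u v [C FC Cu] [D FD Dv]|y [C FC Cy]|u v [C FC Cu] Av].
  - have [CD|DC] := Ftot _ _ FC FD.
      by exists D => //; have [DB _ _] := FP _ FD; apply: DB => //; apply: CD.
    by exists C => //; have [CB _ _] := FP _ FC; apply: CB => //; apply: DC.
  - by have [_ Cf _] := FP _ FC; apply: Cf.
  - by exists C => //; have [_ _ CA] := FP _ FC; apply: CA Cu Av.
have B0 : B 0.
  apply: contrapT => nB0; apply: (Bmax A); last by split=> //; apply: AS.2.
  split=> [u Bu|AB]; first by case: nB0; apply: BA Bu AS.1.
  by apply/nB0/AB/AS.1.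
have BS : subgroup B by [].
have dom x : exists y, B (x, y).
  apply: contrapT => nx; have [y yP] := compatible_value x BS Bf.
  (* The subgroup generated by [B] and [(x, y)], functional by the choice of [y]. *)
  pose C (u : G * QZ) := exists2 n : int, True & B (u - (x, y) *~ n).
  apply: (Bmax C); [split=> [u Bu|CB] |
    split=> [u v [m _ Bu] [n _ Bv]|z [n _]|u v _ Av]].
  - by exists 0 => //; rewrite mulr0z subr0.
  - apply: nx; exists y; apply: CB; exists 1 => //.
    by rewrite mulr1z subrr.
  - by exists (m - n) => //; rewrite mulrzBr subrACA; apply: BB.
  - rewrite pair_mulz => Bz.
    have /yP : B (x *~ (- n), z - y *~ n).
      by move: Bz; rewrite mulrNz -[- (x *~ n)]add0r.
    by rewrite mulrNz => /eqP; rewrite subr_eq addNr => /eqP.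
  - by exists 0 => //; rewrite mulr0z subr0; apply: BA B0 Av.
have Bfun u v w : B (u, v) -> B (u, w) -> v = w.
  move=> Bv Bw; apply/subr0_eq/Bf; rewrite -(subrr u).
  exact: (BB (_, _) (_, _)).
have [chi chiP] := choice dom.
have chiA : zmod_morphism chi.
  by move=> u v; apply: Bfun (chiP _) _; apply: (BB (_, _) (_, _)).
exists (Additive chiA) => x y Axy.
by apply: Bfun (chiP x) _; apply: BA B0 Axy.
Qed.

End Extension.

Lemma character_extend (G H : zmodType) (j : {additive G -> H}) :
  injective j -> forall f : {additive G -> QZ},
  exists g : {additive H -> QZ}, forall x, g (j x) = f x.
Proof.
move=> j_inj f.
have [||g gP] := @character_extension H (fun u => exists x, (j x, f x) = u).
- split=> [|_ _ [x <-] [y <-]]; first by exists 0; rewrite !raddf0.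
  by exists (x - y); rewrite !raddfB.
- by move=> y [x [/eqP]]; rewrite raddf_eq0 // => /eqP-> <-; rewrite raddf0.
by exists g => x; apply: gP; exists x.
Qed.

(** Let [d] be the order of [x] modulo [S], with 0 for infinite order. As [d] is not 1, some nonzero
    [y] is killed by [d]; sending [S] to 0 and [x] to [y] is then well defined and extends to
    [G]. *)
Lemma character_separation (G : zmodType) (S : G -> Prop) (x : G) :
  subgroup S -> ~ S x -> exists chi : {additive G -> QZ},
  (forall y, S y -> chi y = 0) /\ chi x != 0.
Proof.
move=> SS Sx; have [S0 SB] := SS.
have [|d [Sd dP]] := @int_subgroup_cyclic (fun n => S (x *~ n)).
  by split=> [|m n Sm Sn]; rewrite ?mulr0z // mulrzBr; apply: SB.
have [|y y0 yd] := @QZ_torsion d.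
  by apply: contra_notN Sx => /eqP d1; rewrite d1 in Sd.
have [||g gP] := @character_extension G
    (fun u => exists2 n, S (u.1 - x *~ n) & u.2 = y *~ n).
- split=> [|u v [m Sm Em] [n Sn En]].
    by exists 0; rewrite ?mulr0z ?subr0.
  exists (m - n); rewrite /= ?mulrzBr ?Em ?En //.
  by rewrite subrACA; apply: SB.
- move=> z [n /=]; rewrite sub0r => /(subgroupN SS); rewrite opprK => /dP.
  by case=> k -> ->; rewrite mulrC mulrzA yd mul0rz.
exists g; split=> [z Sz|].
  by apply: gP; exists 0; rewrite ?mulr0z ?subr0.
by rewrite (gP x y) //; exists 1; rewrite ?mulr1z ?subrr.
Qed.

(** * Character modules, the tensor-hom adjunction and purity *)

Lemma tens_ext (R : pzRingType) (N : lmodType R^c) (A : lmodType R)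
    (G : zmodType) (f g : {additive tensor N A -> G}) :
  (forall n a, f (tens n a) = g (tens n a)) -> f =1 g.
Proof.
move=> fg t; rewrite -[t]reprK -[repr t]freeg_sumE !raddf_sum /=.
apply: eq_bigr => -[n a] _.
have := freegU_mulz int (coeff (n, a) (repr t)) (n, a).
by rewrite intz => <-; rewrite !raddfMz; congr (_ *~ _); apply: fg.
Qed.

Section Characters.
Variables (R : pzRingType) (N : lmodType R^c).

Lemma additive_is_char (chi : {additive N -> QZ}) :
  (chi : N -> QZ) \in @is_char R N.
Proof. by rewrite inE => x y; rewrite raddfB. Qed.

Definition char_of_additive (chi : {additive N -> QZ}) : character_module N :=
  CharacterModule (additive_is_char chi).

Lemma char_ext (chi psi : character_module N) : chi =1 psi -> chi = psi.
Proof. by move=> E; apply/val_inj/funext. Qed.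

Lemma charD (chi psi : character_module N) n : (chi + psi) n = chi n + psi n.
Proof. by []. Qed.

Lemma charZ r (chi : character_module N) n :
  (r *: chi) n = chi ((r : R^c) *: n).
Proof. by []. Qed.

Lemma char_sum (I : Type) (s : seq I) (F : I -> character_module N) n :
  (\sum_(i <- s) F i) n = \sum_(i <- s) F i n.
Proof.
by elim/big_rec2: _ => [|i x y _ <-]; rewrite ?charD.
Qed.

Variable A : lmodType R.

Lemma char_pairing_balanced (f : {linear A -> character_module N}) :
  balanced (fun n a => f a n).
Proof.
by split=> [n n' a|n a a'|r n a]; rewrite ?raddfD // linearZ.
Qed.

Definition char_uncurry (f : {linear A -> character_module N}) :
    {additive tensor N A -> QZ} :=
  Additive (tens_lift_zmod_morphism (char_pairing_balanced f)).

Lemma char_uncurryE f n a : char_uncurry f (tens n a) = f a n.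
Proof. exact: (tens_liftE (char_pairing_balanced f)). Qed.

Variable omega : {additive tensor N A -> QZ}.

Lemma tens_slice_additive a : zmod_morphism (fun n : N => omega (tens n a)).
Proof.
have [tDl _ _] := tens_balanced N A.
move=> x y; rewrite -raddfB; congr (omega _).
by apply/eqP; rewrite eq_sym subr_eq -tDl subrK.
Qed.

Definition tens_slice a := char_of_additive (Additive (tens_slice_additive a)).

Lemma tens_slice_linear : linear tens_slice.
Proof.
have [_ tDr tZ] := tens_balanced N A.
by move=> r a b; apply: char_ext => n; rewrite charD charZ /= tDr raddfD tZ.
Qed.

Definition char_curry : {linear A -> character_module N} :=
  Linear tens_slice_linear.

End Characters.

(** By adjunction, extending a map [A -> N^+] along [i] amounts to extending a character of
    [N \otimes A] along the injective [N \otimes i]. *)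
Lemma char_pure_injective (R : pzRingType) (N : lmodType R^c) :
  pure_injective (character_module N).
Proof.
move=> A B i [_ i_pure] f.
have [g gP] := character_extend (i_pure N) (char_uncurry f).
exists (char_curry g) => a; apply: char_ext => n /=.
by rewrite -(char_uncurryE f) -gP /= tensor_map_tens.
Qed.

(* Dualizing a pure monomorphism splits: extend the evaluation pairing on
   A \otimes A^+ to B \otimes A^+. *)
Lemma rpure_mono_dual_split (R : pzRingType) (A B : lmodType R^c)
    (i : {linear A -> B}) : rpure_mono i ->
  exists sigma : {linear character_module A -> character_module B},
    forall chi a, sigma chi (i a) = chi a.
Proof.
move=> [_ i_pure].
have [g gP] := character_extend (i_pure (character_module A))
  (char_uncurry (idfun : {linear character_module A -> character_module A})).
exists (char_curry g) => chi a.
by have := gP (tens a chi); rewrite char_uncurryE /= tensor_map_tens.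
Qed.

(** The injective map [N \otimes i] factors with [N \otimes h] applied first. *)
Lemma pure_mono_comp_inv (R : pzRingType) (A B C : lmodType R)
    (h : {linear A -> B}) (g : {linear B -> C}) (i : {linear A -> C}) :
  g \o h =1 i -> pure_mono i -> pure_mono h.
Proof.
move=> ghi [i_inj i_pure]; split=> [x y hxy|N x y hxy].
  by apply: i_inj; rewrite -!ghi /= hxy.
pose idN : {linear N -> N} := idfun.
have E t : tensor_map idN i t = tensor_map idN g (tensor_map idN h t).
  apply: (@tens_ext _ _ _ _ _ (tensor_map idN g \o tensor_map idN h)) => n a /=.
  by rewrite !tensor_map_tens /= -ghi.
by apply: (i_pure N); rewrite !E hxy.
Qed.

(** * Finite linear systems and their lifting along pure epimorphisms *)

Definition lin_comb (S : pzRingType) (V : lmodType S) (X : Type) (e : X -> V)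
    (rho : seq (S * X)) : V :=
  \sum_(p <- rho) p.1 *: e p.2.

Section LinearCombinations.
Variables (S : pzRingType) (X : eqType).
Implicit Types (rho : seq (S * X)).

(** An equation [rho] may mention an unknown several times; this collects its coefficients. *)
Definition total_coef (x : X) rho : S := \sum_(p <- rho | p.2 == x) p.1.

Lemma lin_comb_linear (U V : lmodType S) (f : {linear U -> V}) (e : X -> U)
    rho :
  lin_comb (f \o e) rho = f (lin_comb e rho).
Proof.
by rewrite /lin_comb linear_sum; apply: eq_bigr => p _; rewrite linearZ.
Qed.

Variable V : lmodType S.

Lemma lin_combB (e e' : X -> V) rho :
  lin_comb (fun x => e x - e' x) rho = lin_comb e rho - lin_comb e' rho.
Proof.
by rewrite /lin_comb -sumrB; apply: eq_bigr => p _; rewrite scalerBr.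
Qed.

Lemma lin_comb_delta (x : X) (v : V) rho :
  lin_comb (fun x' => if x' == x then v else 0) rho = total_coef x rho *: v.
Proof.
rewrite /lin_comb /total_coef scaler_suml [RHS]big_mkcond /=.
by apply: eq_bigr => p _; case: eqP => // _; rewrite scaler0.
Qed.

Lemma lin_comb_collect (W : seq X) (e : X -> V) rho :
  uniq W -> {subset [seq p.2 | p <- rho] <= W} ->
  lin_comb e rho = \sum_(x <- W) total_coef x rho *: e x.
Proof.
move=> W_uniq rhoW; under [RHS]eq_bigr => x _.
  rewrite /total_coef scaler_suml big_mkcond /=; over.
rewrite exchange_big /=; apply: eq_big_seq => p rho_p.
have Wp : p.2 \in W by apply: rhoW; apply: map_f.
rewrite (bigD1_seq p.2) //= eqxx big1_seq ?addr0 // => x /andP[xp _].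
by rewrite eq_sym (negbTE xp).
Qed.

End LinearCombinations.

Lemma fct_delta_sum (I : finType) (A : zmodType) (g : I -> A) :
  g = \sum_i (fun i' => if i' == i then g i else 0).
Proof.
apply/funext => i; rewrite fct_sumE (bigD1 i) //= eqxx big1 ?addr0 // => j ji.
by rewrite eq_sym (negbTE ji).
Qed.

(* The defects of an arbitrary lift form a vector over A; if it were not the
   defect vector of a family in A, a character separating it would be carried to
   B by the splitting of B^+ -> A^+, where it kills all defect vectors. *)
Lemma rpure_exact_lift_system (R : pzRingType) (A B C : lmodType R^c)
    (i : {linear A -> B}) (q : {linear B -> C}) : rpure_exact i q ->
  forall (X : eqType) (s : seq (seq (R^c * X))) (c : X -> C),
  (forall rho, rho \in s -> lin_comb c rho = 0) ->
  exists b : X -> B, (forall x, q (b x) = c x) /\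
    forall rho, rho \in s -> lin_comb b rho = 0.
Proof.
move=> [i_pure q_ker q_surj] X s c cs.
have [b0 b0P] := choice (fun x => q_surj (c x)).
pose rho_ (k : 'I_(size s)) := nth [::] s k.
have rho_s k : rho_ k \in s by apply: mem_nth.
have ex_a k : exists a, i a = lin_comb b0 (rho_ k).
  apply/q_ker; rewrite -lin_comb_linear -(cs _ (rho_s k)).
  by apply: eq_bigr => p _ /=; rewrite b0P.
have [a aP] := choice ex_a.
pose Im (g : 'I_(size s) -> A) :=
  exists a', forall k, g k = lin_comb a' (rho_ k).
have ImS : subgroup Im.
  split=> [|g h [g' gP] [h' hP]].
    by exists (fun=> 0) => k; rewrite /lin_comb big1 // => p _; rewrite scaler0.
  by exists (fun x => g' x - h' x) => k; rewrite lin_combB -gP -hP.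
case: (pselect (Im a)) => [[a' a'P]|nIm].
  exists (fun x => b0 x - i (a' x)); split=> [x|rho /(nthP [::])[k ks <-]].
    rewrite raddfB /= b0P (_ : q (i _) = 0) ?subr0 //.
    by apply/q_ker; exists (a' x).
  have := aP (Ordinal ks); rewrite a'P -lin_comb_linear => E.
  by rewrite lin_combB -[lin_comb b0 _]E subrr.
have [chi [chi0 /eqP[]]] := character_separation ImS nIm.
have deltaA k :
    zmod_morphism (fun x : A => chi (fun k' => if k' == k then x else 0)).
  move=> x y; rewrite -raddfB; congr (chi _); apply/funext => k'.
  rewrite -[RHS]/((if k' == k then x else 0) - (if k' == k then y else 0)).
  by case: ifP; rewrite ?subr0.
pose chi_ k := char_of_additive (Additive (deltaA k)).
have chiE g : chi g = \sum_k chi_ k (g k).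
  by rewrite {1}[g]fct_delta_sum raddf_sum.
have [sigma sigmaP] := rpure_mono_dual_split i_pure.
(* [chi] kills the defect vector of the family with value [y] at [x] and 0 elsewhere. Read on the
   components [chi_ k], this is a linear relation in [A^+], which [sigma] carries to [B^+]. *)
have coef0 x : \sum_k (total_coef x (rho_ k) : R) *: chi_ k = 0.
  apply: char_ext => y; rewrite char_sum.
  under eq_bigr => k _ do rewrite charZ -lin_comb_delta.
  by rewrite -(chiE (fun k => lin_comb _ (rho_ k))); apply: chi0; eexists.
(* The finitely many unknowns that occur in [s]: the sum over equations is exchanged with a sum over
   them. *)
pose W := undup (flatten [seq [seq p.2 | p <- rho] | rho <- s]).
have rhoW k : {subset [seq p.2 | p <- rho_ k] <= W}.
  move=> x xk; rewrite mem_undup; apply/flattenP.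
  by exists [seq p.2 | p <- rho_ k] => //; apply: map_f.
rewrite chiE; under eq_bigr => k _.
  rewrite -sigmaP aP (lin_comb_collect _ (undup_uniq _) (@rhoW k)) raddf_sum.
  under eq_bigr => x _ do rewrite /= -charZ -linearZ.
  over.
rewrite exchange_big big1 //= => x _.
by rewrite -(char_sum _ _ (b0 x)) -linear_sum coef0 linear0.
Qed.

(** * Modules given by generators and relations *)

Section Presentation.
Variables (S : pzRingType) (T : Type).

(** Formal terms modulo the congruence generated by the module axioms and [rel] form the presented
    module directly, without a free module and a submodule of relations. *)
Inductive term :=
| TZero | TAdd of term & term | TOpp of term | TScale of S & term | TGen of T.

Variable rel : term -> Prop.

Inductive term_eqv : term -> term -> Prop :=
| EqvRefl t : term_eqv t t
| EqvSym t u : term_eqv t u -> term_eqv u t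
| EqvTrans t u v : term_eqv t u -> term_eqv u v -> term_eqv t v
| EqvAdd t t' u u' : term_eqv t t' -> term_eqv u u' ->
    term_eqv (TAdd t u) (TAdd t' u')
| EqvOpp t t' : term_eqv t t' -> term_eqv (TOpp t) (TOpp t')
| EqvScale r t t' : term_eqv t t' -> term_eqv (TScale r t) (TScale r t')
| EqvAddA t u v : term_eqv (TAdd t (TAdd u v)) (TAdd (TAdd t u) v)
| EqvAddC t u : term_eqv (TAdd t u) (TAdd u t)
| EqvAdd0 t : term_eqv (TAdd TZero t) t
| EqvAddN t : term_eqv (TAdd (TOpp t) t) TZero
| EqvScaleA a b t : term_eqv (TScale a (TScale b t)) (TScale (a * b) t)
| EqvScale1 t : term_eqv (TScale 1 t) t
| EqvScaleDr a t u :
    term_eqv (TScale a (TAdd t u)) (TAdd (TScale a t) (TScale a u))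
| EqvScaleDl a b t :
    term_eqv (TScale (a + b) t) (TAdd (TScale a t) (TScale b t))
| EqvRel t : rel t -> term_eqv t TZero.

HB.instance Definition _ := gen_eqMixin term.
HB.instance Definition _ := gen_choiceMixin term.

Definition term_eqvb (t u : term) := `[< term_eqv t u >].

Lemma term_eqvb_equiv : equiv_class_of term_eqvb.
Proof.
split=> [t|t u|u t v]; first exact/asboolP/EqvRefl.
  by apply/asboolP/asboolP => ?; apply: EqvSym.
by move=> /asboolP ? /asboolP ?; apply/asboolP; apply: EqvTrans; eassumption.
Qed.

Canonical term_equiv_rel := EquivRelPack term_eqvb_equiv.
Canonical term_enc_mod_rel := defaultEncModRel term_eqvb.

Definition presented := {eq_quot term_eqvb}.
HB.instance Definition _ := Choice.on presented.

Local Notation cl := (\pi_presented).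

Lemma cl_eq t u : cl t = cl u <-> term_eqv t u.
Proof. by split=> [/eqmodP/asboolP|E]; last exact/eqmodP/asboolP. Qed.

Lemma repr_eqv t : term_eqv (repr (cl t)) t.
Proof. by apply/cl_eq; rewrite reprK. Qed.

Definition pres_add (x y : presented) : presented :=
  cl (TAdd (repr x) (repr y)).
Definition pres_opp (x : presented) : presented := cl (TOpp (repr x)).
Definition pres_scale (a : S) (x : presented) : presented :=
  cl (TScale a (repr x)).

Lemma pres_addE t u : pres_add (cl t) (cl u) = cl (TAdd t u).
Proof. by apply/cl_eq/EqvAdd; apply: repr_eqv. Qed.

Lemma pres_oppE t : pres_opp (cl t) = cl (TOpp t).
Proof. by apply/cl_eq/EqvOpp/repr_eqv. Qed.

Lemma pres_scaleE a t : pres_scale a (cl t) = cl (TScale a t).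
Proof. by apply/cl_eq/EqvScale/repr_eqv. Qed.

Lemma pres_addA : associative pres_add.
Proof.
elim/quotW=> t; elim/quotW=> u; elim/quotW=> v.
rewrite (pres_addE u v) (pres_addE t) (pres_addE t u) (pres_addE _ v).
exact/cl_eq/EqvAddA.
Qed.

Lemma pres_addC : commutative pres_add.
Proof. by move=> x y; apply/cl_eq/EqvAddC. Qed.

Lemma pres_add0 : left_id (cl TZero) pres_add.
Proof. by elim/quotW=> t; rewrite pres_addE; apply/cl_eq/EqvAdd0. Qed.

Lemma pres_addN : left_inverse (cl TZero) pres_opp pres_add.
Proof.
by elim/quotW=> t; rewrite pres_oppE (pres_addE _ t); apply/cl_eq/EqvAddN.
Qed.

HB.instance Definition _ := GRing.isZmodule.Build presented
  pres_addA pres_addC pres_add0 pres_addN.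

Lemma cl_add t u : (cl t : presented) + (cl u : presented) = cl (TAdd t u).
Proof. exact: pres_addE. Qed.

Lemma pres_scaleA a b x :
  pres_scale a (pres_scale b x) = pres_scale (a * b) x.
Proof.
elim/quotW: x => t; rewrite (pres_scaleE b) !pres_scaleE.
exact/cl_eq/EqvScaleA.
Qed.

Lemma pres_scale1 : left_id 1 pres_scale.
Proof. by elim/quotW=> t; rewrite pres_scaleE; apply/cl_eq/EqvScale1. Qed.

Lemma pres_scaleDr : right_distributive pres_scale +%R.
Proof.
move=> a; elim/quotW=> t; elim/quotW=> u.
rewrite (pres_scaleE a t) (pres_scaleE a u) !cl_add pres_scaleE.
by apply/cl_eq/EqvScaleDr.
Qed.

Lemma pres_scaleDl x : {morph pres_scale^~ x : a b / a + b >-> a + b}.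
Proof.
move=> a b; elim/quotW: x => t; rewrite !pres_scaleE cl_add.
by apply/cl_eq/EqvScaleDl.
Qed.

HB.instance Definition _ := GRing.Zmodule_isLmodule.Build S presented
  pres_scaleA pres_scale1 pres_scaleDr pres_scaleDl.

Definition pres_gen (x : T) : presented := cl (TGen x).

Fixpoint term_eval (V : lmodType S) (e : T -> V) (t : term) : V :=
  match t with
  | TZero => 0
  | TAdd t u => term_eval e t + term_eval e u
  | TOpp t => - term_eval e t
  | TScale a t => a *: term_eval e t
  | TGen x => e x
  end.

Lemma term_eval_gen t : term_eval pres_gen t = cl t.
Proof.
elim: t => //= [t -> u ->|t ->|a t ->];
  [exact: pres_addE|exact: pres_oppE|exact: pres_scaleE].
Qed.

Lemma term_eval_linear (U V : lmodType S) (f : {linear U -> V}) (e : T -> U) t :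
  term_eval (f \o e) t = f (term_eval e t).
Proof.
elim: t => /= [|t -> u ->|t ->|a t ->|//];
  by rewrite ?raddf0 ?raddfD ?raddfN ?linearZ.
Qed.

Lemma pres_rel t : rel t -> term_eval pres_gen t = 0.
Proof. by move=> rt; rewrite term_eval_gen; apply/cl_eq/EqvRel. Qed.

Lemma pres_ext (V : lmodType S) (f g : {linear presented -> V}) :
  (forall x, f (pres_gen x) = g (pres_gen x)) -> f =1 g.
Proof.
move=> fg; elim/quotW=> t; rewrite -term_eval_gen -!term_eval_linear.
by congr term_eval; apply/funext.
Qed.

Section Universal.
Variables (V : lmodType S) (e : T -> V).
Hypothesis eP : forall t, rel t -> term_eval e t = 0.

Lemma term_eval_eqv t u : term_eqv t u -> term_eval e t = term_eval e u.
Proof.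
elim=> //= {t u}.
- by move=> t u v _ -> _ ->.
- by move=> t t' u u' _ -> _ ->.
- by move=> t t' _ ->.
- by move=> a t t' _ ->.
- by move=> t u v; rewrite addrA.
- by move=> t u; rewrite addrC.
- by move=> t; rewrite add0r.
- by move=> t; rewrite addNr.
- by move=> a b t; rewrite scalerA.
- by move=> t; rewrite scale1r.
- by move=> a t u; rewrite scalerDr.
- by move=> a b t; rewrite scalerDl.
Qed.

Lemma pres_eval_linear : linear (fun x : presented => term_eval e (repr x)).
Proof.
move=> a x y; rewrite -[RHS]/(term_eval e (TAdd (TScale a (repr x)) (repr y))).
apply/term_eval_eqv/cl_eq; rewrite reprK.
by rewrite -pres_addE -pres_scaleE !reprK.
Qed.

Lemma pres_universal :
  exists f : {linear presented -> V}, forall x, f (pres_gen x) = e x.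
Proof.
exists (Linear pres_eval_linear) => x /=.
exact: (term_eval_eqv (repr_eqv (TGen x))).
Qed.

End Universal.
End Presentation.

(** * The pure-projective module built from finite systems *)

Section FiniteSystemCover.
Variables (S : pzRingType) (B : lmodType S).

Definition system := seq (seq (S * B)).

Definition comb_term (s : system) (rho : seq (S * B)) : term S (system * B) :=
  foldr (fun p t => TAdd (TScale p.1 (TGen S (s, p.2))) t) (TZero S _) rho.

Lemma comb_term_eval (V : lmodType S) (e : system * B -> V) s rho :
  term_eval e (comb_term s rho) = lin_comb (fun b => e (s, b)) rho.
Proof.
rewrite /lin_comb; elim: rho => [|p rho IH] /=; first by rewrite big_nil.
by rewrite big_cons IH.
Qed.

Definition cover_rel (t : term S (system * B)) : Prop :=
  exists s rho, [/\ rho \in s, lin_comb id rho = 0 & t = comb_term s rho].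

(* The direct sum, over all finite systems s, of the module with generators
   e_(s, b), b : B, subject to those equations of s that hold in B. *)
Definition system_cover : lmodType S := presented cover_rel.

Definition cover_gen (s : system) (b : B) : system_cover :=
  pres_gen cover_rel (s, b).

Lemma cover_gen_rel s rho :
  rho \in s -> lin_comb id rho = 0 -> lin_comb (cover_gen s) rho = 0.
Proof.
move=> rho_s rho0; rewrite -(comb_term_eval (pres_gen cover_rel)).
by apply: pres_rel; exists s, rho.
Qed.

Lemma cover_ext (V : lmodType S) (f g : {linear system_cover -> V}) :
  (forall s b, f (cover_gen s b) = g (cover_gen s b)) -> f =1 g.
Proof. by move=> fg; apply: pres_ext => -[s b]; apply: fg. Qed.

Lemma cover_universal (V : lmodType S) (e : system -> B -> V) :
  (forall s rho, rho \in s -> lin_comb id rho = 0 -> lin_comb (e s) rho = 0) ->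
  exists f : {linear system_cover -> V}, forall s b, f (cover_gen s b) = e s b.
Proof.
move=> eP; pose e' (sb : system * B) := e sb.1 sb.2.
have [|f fP] := @pres_universal _ _ cover_rel V e'.
  by move=> _ [s [rho [? ? ->]]]; rewrite comb_term_eval; apply: eP.
by exists f => s b; apply: (fP (s, b)).
Qed.

Lemma cover_proj :
  exists q : {linear system_cover -> B}, forall s b, q (cover_gen s b) = b.
Proof. exact: (@cover_universal B (fun _ => id)). Qed.

End FiniteSystemCover.

(** For each [s], the images of the generators under [f] solve finitely many equations, though in
    possibly infinitely many unknowns. Such solutions lift for each [s] separately, and the
    universal property assembles the lifts. *)
Lemma cover_pure_projective (R : pzRingType) (B : lmodType R^c) :
  rpure_projective (system_cover B).
Proof.
move=> A E C i q iq f.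
have lift s : exists e : B -> E, (forall b, q (e b) = f (cover_gen s b)) /\
    forall rho, rho \in s -> lin_comb id rho = 0 -> lin_comb e rho = 0.
  (* Equations of [s] that fail in [B] impose nothing on the generators, so they are dropped. *)
  pose s' := [seq rho <- s | lin_comb id rho == 0 :> B].
  have [|e [qe es]] := rpure_exact_lift_system iq
      (s := s') (c := f \o cover_gen s).
    move=> rho; rewrite mem_filter => /andP[/eqP rho0 rho_s].
    by rewrite lin_comb_linear cover_gen_rel ?raddf0.
  exists e; split=> // rho rho_s rho0; apply: es.
  by rewrite mem_filter rho0 eqxx.
have [e eP] := choice lift.
have [|g gP] := @cover_universal _ _ _ e; first by move=> s; apply: (eP s).2.
exists g; apply: (@cover_ext _ _ _ (q \o g) f) => s b /=.
by rewrite gP (eP s).1.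
Qed.

(** * The dual right module and the map from M to the dual of the cover *)

Section ConverseTwice.
Variables (R : pzRingType) (M : lmodType R).

(* R^c^c is not convertible to R for abstract R. *)
Definition converse2 : Type := M.

HB.instance Definition _ := GRing.Zmodule.on converse2.

Definition converse2_scale (r : R^c^c) (m : converse2) : converse2 :=
  ((r : R) *: (m : M) : M).

Lemma converse2_scaleA a b m :
  converse2_scale a (converse2_scale b m) = converse2_scale (a * b) m.
Proof. exact: scalerA. Qed.

Lemma converse2_scale1 : left_id 1 converse2_scale.
Proof. exact: scale1r. Qed.

Lemma converse2_scaleDr : right_distributive converse2_scale +%R.
Proof. by move=> a m m'; apply: (@scalerDr R M). Qed.

Lemma converse2_scaleDl m :
  {morph converse2_scale^~ m : a b / a + b >-> a + b}.
Proof. by move=> a b; apply: (@scalerDl R M). Qed.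

HB.instance Definition _ := GRing.Zmodule_isLmodule.Build R^c^c converse2
  converse2_scaleA converse2_scale1 converse2_scaleDr converse2_scaleDl.

End ConverseTwice.

Section Cocover.
Variables (R : pzRingType) (M : lmodType R).

(* M^+ as a right module *)
Definition ldual : lmodType R^c := character_module (converse2 M).

Variable q : {linear system_cover ldual -> ldual}.

Lemma dual_eval_additive (m : M) :
  zmod_morphism (fun p : system_cover ldual => q p m).
Proof. by move=> x y; rewrite raddfB. Qed.

Definition dual_eval (m : M) : character_module (system_cover ldual) :=
  char_of_additive (Additive (dual_eval_additive m)).

Lemma dual_eval_linear : linear dual_eval.
Proof.
move=> r m m'; apply: char_ext => p; rewrite charD charZ /=.
by rewrite linearZ raddfD.
Qed.

(** Evaluation of [M] in its double dual, followed by the transpose of [q]. *)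
Definition cocover : {linear M -> character_module (system_cover ldual)} :=
  Linear dual_eval_linear.

End Cocover.

(** * Limits along finite systems *)

Section GeneratorsEventuallyLinear.
Variables (S : pzRingType) (B : lmodType S).

(** The instance of additivity is a single equation true in [B], hence imposed on the generators of
    every [s] that contains it. *)
Lemma cover_genD (b b' : B) : exists s0 : system B, forall s,
  {subset s0 <= s} ->
  cover_gen s (b + b') = cover_gen s b + cover_gen s b'.
Proof.
exists [:: [:: (1, b + b'); (-1, b); (-1, b')]] => s s0s.
have := @cover_gen_rel _ _ s _ (s0s _ (mem_head _ _)).
rewrite /lin_comb !big_cons !big_nil /= !scale1r !scaleN1r !addr0.
rewrite -!opprD => /(_ (subrr _)) /subr0_eq; exact.
Qed.

Lemma cover_genZ (r : S) (b : B) : exists s0 : system B, forall s,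
  {subset s0 <= s} -> cover_gen s (r *: b) = r *: cover_gen s b.
Proof.
exists [:: [:: (1, r *: b); (- r, b)]] => s s0s.
have := @cover_gen_rel _ _ s _ (s0s _ (mem_head _ _)).
rewrite /lin_comb !big_cons !big_nil /= !scale1r !scaleNr !addr0.
by move=> /(_ (subrr _)) /subr0_eq.
Qed.

End GeneratorsEventuallyLinear.

(* A limit along the finite systems, ordered by inclusion. *)
Lemma system_limit (S : pzRingType) (B : lmodType S) (c : QZ) : c != 0 ->
  exists lambda : {additive (system B -> QZ) -> QZ},
    lambda (fun=> c) != 0 /\
    forall F F' : system B -> QZ,
      (exists s0 : system B, forall s, {subset s0 <= s} -> F s = F' s) ->
      lambda F = lambda F'.
Proof.
move=> c0.
pose ev0 (F : system B -> QZ) :=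
  exists s0 : system B, forall s, {subset s0 <= s} -> F s = 0.
have ev0S : subgroup ev0.
  split=> [|F F' [s0 Fs0] [s1 Fs1]]; first by exists [::].
  exists (s0 ++ s1) => s s01; rewrite -[LHS]/(F s - F' s).
  rewrite Fs0 ?Fs1 ?subr0 // => x xs; apply: s01; rewrite mem_cat xs ?orbT //.
(* The constant function [c] is not eventually zero, being nonzero at [s0] itself. A character that
   vanishes on all eventually zero functions but not on this one serves as the limit. *)
have [|lambda [lambda0 lambdac]] := character_separation ev0S (x := fun=> c).
  by move=> [s0 /(_ s0)] E; move: c0; rewrite E ?eqxx.
exists lambda; split=> // F F' [s0 E]; apply/subr0_eq; rewrite -raddfB.
by apply: lambda0; exists s0 => s /E FF'; rewrite -[LHS]/(F s - F' s) FF' subrr.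
Qed.

(** * Purity of the map into the dual of the cover *)

Section CocoverPure.
Variables (R : pzRingType) (M : lmodType R).
Variables (q : {linear system_cover (ldual M) -> ldual M}).
Hypothesis qE : forall s b, q (cover_gen s b) = b.

(** A character [chi] with [chi m] nonzero is the image under [q] of a generator, and the empty
    system already provides one. *)
Lemma cocover_injective : injective (cocover q).
Proof.
apply: raddf_inj => m m0; apply: contrapT => mn0.
have [||chi [_ /eqP[]]] := @character_separation M (eq 0) m.
- by split=> // x y <- <-; rewrite subr0.
- by move=> /esym.
have -> : chi m = cocover q m
    (cover_gen [::] (char_of_additive (N := converse2 M) chi)).
  by rewrite /= qE.
by rewrite m0.
Qed.

Section Tensor.
Variables (N : lmodType R^c) (chi : {additive tensor N M -> QZ}).

Lemma tens_row_additive (n : N) :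
  zmod_morphism (fun m : converse2 M => chi (tens n (m : M))).
Proof.
have [_ tDr _] := tens_balanced N M.
move=> x y; rewrite -raddfB; congr (chi _).
by apply/eqP; rewrite eq_sym subr_eq -tDr; rewrite -[_ + _]/(x - y + y) subrK.
Qed.

Definition tens_row (n : N) : ldual M :=
  char_of_additive (Additive (tens_row_additive n)).

Lemma tens_row_linear : linear tens_row.
Proof.
have [tDl _ tZ] := tens_balanced N M.
by move=> r n n'; apply: char_ext => m; rewrite charD charZ /= tDl raddfD tZ.
Qed.

End Tensor.

(* If [t <> 0], pick chi with chi t <> 0 and let phi : N -> M^+ be its
   transpose. The generators e_(s, phi n) are eventually linear in n, so
   n \otimes xi |-> lim_s xi (e_(s, phi n)) is a functional on N \otimes P^+,
   and it restricts to (the limit of the constant) chi on N \otimes M. *)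
Lemma cocover_pure : pure_mono (cocover q).
Proof.
split=> [|N]; first exact: cocover_injective.
apply: raddf_inj => t t0; apply: contrapT => tn0.
have [||chi [_ chit]] := @character_separation _ (eq 0) t.
- by split=> // x y <- <-; rewrite subr0.
- by move=> /esym.
have [lambda [lambdac lambda_ev]] := system_limit (ldual M) chit.
pose phi : {linear N -> ldual M} := Linear (tens_row_linear chi).
pose b n (xi : character_module (system_cover (ldual M))) :=
  lambda (fun s => xi (cover_gen s (phi n))).
have b_bal : balanced b.
  split=> [n n' xi|n xi xi'|r n xi]; rewrite /b -?raddfD; apply: lambda_ev.
  - have [s0 s0P] := cover_genD (phi n) (phi n').
    by exists s0 => s /s0P E; rewrite raddfD E raddfD.
  - by exists [::].
  - have [s0 s0P] := cover_genZ (r : R^c) (phi n).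
    by exists s0 => s /s0P E; rewrite linearZ E charZ.
(* [lambda] need not send a constant to its value, so the comparison is with this map rather than
   with [chi]; by the choice of [lambda] it is nonzero at [t]. *)
have constA : zmod_morphism (fun t : tensor N M => lambda (fun=> chi t)).
  move=> x y; rewrite -raddfB; congr (lambda _).
  by apply/funext => s; rewrite raddfB.
pose beta := Additive (tens_lift_zmod_morphism b_bal).
pose j := tensor_map (idfun : {linear N -> N}) (cocover q).
have E : beta \o j =1 Additive constA.
  apply: (@tens_ext _ _ _ _ (beta \o j)) => n m.
  rewrite /= /j tensor_map_tens [LHS](tens_liftE b_bal) /b.
  by congr (lambda _); apply/funext => s /=; rewrite qE.
have : beta (j t) = 0 by rewrite /j t0 raddf0.
by rewrite [LHS]E => /eqP; apply/negP.
Qed.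

End CocoverPure.

(** * The pure embedding and the cycle of implications *)

Lemma pure_in_dual_of_pure_projective (R : pzRingType) (M : lmodType R) :
  exists (P : lmodType R^c) (i : {linear M -> character_module P}),
    rpure_projective P /\ pure_mono i.
Proof.
have [q qE] := cover_proj (ldual M).
exists (system_cover (ldual M)), (cocover q).
split; first exact: cover_pure_projective.
exact: cocover_pure.
Qed.

Theorem proposition2p9 (R : pzRingType) (X : lmodType R -> Prop)
    (X_precovering : precovering X) (X_iso : iso_closed X)
    (X_sum : finite_sum_closed X) (X_summand : summand_closed X)
    (M : lmodType R) :
  [<-> exists (G : lmodType R) (i : {linear M -> G}), X G /\ pure_mono i;
       forall E : lmodType R,
         pure_injective E -> precover_completing_domain X M E;
       exists (PEM : lmodType R) (u : {linear M -> PEM}),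
         preenvelope (@pure_injective R) u /\
         precover_completing_domain X M PEM;
       forall N : lmodType R^c,
         precover_completing_domain X M (character_module N);
       forall P : lmodType R^c,
         rpure_projective P ->
         precover_completing_domain X M (character_module P)].
Proof.
tfae.
- move=> [G [i [XG i_pure]]] E E_pi f G' g [XG' gP].
  have [f' f'E] := E_pi _ _ _ i_pure f.
  have [h hE] := gP _ f' XG.
  by exists (h \o i) => m; rewrite -f'E; apply: hE.
- move=> all_pi; have [P [i [_ i_pure]]] := pure_in_dual_of_pure_projective M.
  (* Any pure monomorphism into a pure-injective module is a pure-injective preenvelope. *)
  exists (character_module P), i; split; last exact/all_pi/char_pure_injective.
  by split=> [|E f E_pi]; [exact: char_pure_injective|exact: E_pi].
- move=> [PEM [u [[_ uP] PEM_dom]]] N f G g [XG gP].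
  have [h hE] := uP _ f (char_pure_injective (N := N)).
  (* The hypothesis on [PEM] lifts [u] to the precover [G']; since [G'] lies in [X], its map to
     [N^+] through [PEM] lifts along [g]. *)
  have [G' [g' g'_pre]] := X_precovering PEM.
  have [k kE] := PEM_dom u _ _ g'_pre.
  have [l lE] := gP _ (h \o g') g'_pre.1.
  exists (l \o k) => m; rewrite -hE /= -kE /=; exact: lE.
- by move=> dom P _; apply: dom.
- move=> dom; have [P [i [P_pp i_pure]]] := pure_in_dual_of_pure_projective M.
  (* The lift [h] of [i] to a precover of [P^+] lands in a member of [X] and inherits purity from
     [i]. *)
  have [G [g g_pre]] := X_precovering (character_module P).
  have [h hE] := dom P P_pp i _ _ g_pre.
  exists G, h; split; [exact: g_pre.1|exact: pure_mono_comp_inv hE i_pure].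
Qed.
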